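(* Let $b,\alpha,\gamma,\Delta\in\mathbb{C}$ with $b\neq0$ and $\Delta\neq0$. There are nontrivial extensions of conformal $\mathcal{W}(b)$-modules of the form $$0\longrightarrow M(\alpha,\Delta)\longrightarrow E\longrightarrow \mathbb{C}c_\gamma\longrightarrow 0$$ if and only if $\alpha+\gamma=0$ and $\Delta=1$. In this case $\dim_{\mathbb{C}}\mathrm{Ext}\big(\mathbb{C}c_{-\alpha},M(\alpha,1)\big)=1$, and the unique (up to a scalar) nontrivial extension is given by $E=\mathbb{C}[\partial]v_\Delta\oplus\mathbb{C}c_\gamma$ (as a vector space, with $M(\alpha,\Delta)=\mathbb{C}[\partial]v_\Delta$ a submodule) and $$L_\lambda c_\gamma=a\,v_\Delta,\qquad H_\lambda c_\gamma=0,\qquad \partial c_\gamma=\gamma c_\gamma+a\,v_\Delta,$$ where $a$ is a nonzero complex number.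
   Context: For $b\in\mathbb{C}$, $\mathcal{W}(b)=\mathbb{C}[\partial]L\oplus\mathbb{C}[\partial]H$ is the free rank 2 Lie conformal algebra with $\lambda$-brackets $[L_\lambda L]=(\partial+2\lambda)L$, $[L_\lambda H]=(\partial+(1-b)\lambda)H$, $[H_\lambda H]=0$. A conformal module $M$ over a Lie conformal algebra $R$ is a $\mathbb{C}[\partial]$-module with a $\mathbb{C}$-linear map $R\to \mathrm{End}_{\mathbb{C}}(M)\otimes_{\mathbb{C}}\mathbb{C}[\lambda]$, $a\mapsto a_\lambda$, such that $a_\lambda b_\mu-b_\mu a_\lambda=[a_\lambda b]_{\lambda+\mu}$ and $(\partial a)_\lambda=[\partial,a_\lambda]=-\lambda a_\lambda$ for all $a,b\in R$; in particular $a_\lambda(\partial v)=(\partial+\lambda)a_\lambda v$. For $b\ne0$ and $\alpha,\Delta\in\mathbb{C}$ with $\Delta\neq0$, $M(\alpha,\Delta)=\mathbb{C}[\partial]v_\Delta$ is the $\mathcal{W}(b)$-module, free of rank one over $\mathbb{C}[\partial]$, with $L_\lambda v_\Delta=(\partial+\alpha+\Delta\lambda)v_\Delta$, $H_\lambda v_\Delta=0$. For $\gamma\in\mathbb{C}$, $\mathbb{C}c_\gamma$ is the one-dimensional $\mathcal{W}(b)$-module with $L_\lambda c_\gamma=H_\lambda c_\gamma=0$ and $\partial c_\gamma=\gamma c_\gamma$. In $E$, the symbol $c_\gamma$ also denotes a lift of the generator of $\mathbb{C}c_\gamma$. An extension of $W$ by $V$ is an exact sequence of $R$-modules $0\to V\to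 E\to W\to0$. Two extensions $E,E'$ of $W$ by $V$ are equivalent if there is a module homomorphism $\psi:E\to E'$ which together with the identity maps of $V$ and $W$ gives a commutative diagram of exact sequences. An extension is trivial if it is equivalent to the direct sum $V\oplus W$, and nontrivial otherwise. $\mathrm{Ext}(W,V)$ denotes the complex vector space of cocycles describing extensions of $W$ by $V$ (here, the data of the $V$-components of the actions of $\partial$, $L_\lambda$, $H_\lambda$ on a lift of $W$) modulo the coboundaries, i.e. the cocycles of trivial extensions. *)

(* Defs.v *)
From HB Require Import structures.
From mathcomp Require Import all_boot all_order all_algebra.
From mathcomp Require Import complex.
From mathcomp Require Import functions reals.
From mathcomp Require Import ring zify.

Set Implicit Arguments.
Unset Strict Implicit.
Unset Printing Implicit Defensive.

Import GRing.Theory.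
Local Open Scope ring_scope.

(* A polynomial in the formal variable lambda with coefficients in a vector
   space V is represented by its coefficient sequence p : nat -> V, i.e.
   p = \sum_n lambda^n p n, together with a proof that p is eventually zero.
   In two variables, p m n is the coefficient of lambda^m mu^n. *)
Definition lam_mul (K : fieldType) (V : lmodType K) (p : nat -> V) (n : nat) : V :=
  if n is k.+1 then p k else 0.

Section ConformalAction.
Variables (K : fieldType) (A M : lmodType K).
Variables (dA : A -> A) (br : nat -> A -> A -> A).
Variables (dM : M -> M) (act : nat -> A -> M -> M).

(* Coefficient of lambda^m mu^n in
   [a_lambda b]_{lambda+mu} v
     = \sum_j \sum_k lambda^j (lambda + mu)^k (br j a b)_(k) v,
   where only k = m + n - j contributes. *)
Definition bracket_act (m n : nat) (a b : A) (v : M) : M :=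
  \sum_(j < m.+1) act (m + n - j) (br j a b) v *+ 'C(m + n - j, n).

(* a_lambda v = \sum_n lambda^n act n a v. The number of nonzero terms may
   depend on v: on C[d] v_Delta, L_lambda (d^k v_Delta) has degree k or k + 1. *)
Record conformal_action : Prop := ConformalAction {
  cact_dlin : linear dM;
  cact_linl : forall n v, linear (fun a => act n a v);
  cact_linr : forall n a, linear (act n a);
  cact_fin  : forall a v, exists N, forall n, (N <= n)%N -> act n a v = 0;
  (* (d a)_lambda = - lambda a_lambda *)
  cact_dl   : forall n a v, act n (dA a) v = - lam_mul (fun k => act k a v) n;
  (* [d, a_lambda] = - lambda a_lambda *)
  cact_dr   : forall n a v,
    dM (act n a v) - act n a (dM v) = - lam_mul (fun k => act k a v) n;
  (* a_lambda b_mu - b_mu a_lambda = [a_lambda b]_{lambda+mu} *)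
  cact_comm : forall m n a b v,
    act m a (act n b v) - act n b (act m a v) = bracket_act m n a b v }.

(* [a_lambda b] = - [b_{-lambda-d} a]; the right-hand side is
   - \sum_j (- lambda - d)^j (br j b a), a finite sum since br j b a = 0 for
   j >= N. *)
Definition lam_skew : Prop := forall a b N,
  (forall j, (N <= j)%N -> br j b a = 0) ->
  forall n, br n a b =
    - \sum_(j < N) (-1) ^+ j *: (iter (j - n) dA (br j b a) *+ 'C(j, n)).

End ConformalAction.

(* Sesquilinearity and the Jacobi identity say exactly that the lambda-bracket
   is a conformal action of the algebra on itself. *)
Record lie_conformal (K : fieldType) := LieConformal {
  lca_car :> lmodType K;
  lca_d  : lca_car -> lca_car;
  lca_br : nat -> lca_car -> lca_car -> lca_car;
  lca_adj  : conformal_action lca_d lca_br lca_d lca_br;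
  lca_skew : lam_skew lca_d lca_br }.

Record conformal_module (K : fieldType) (A : lie_conformal K) := ConformalModule {
  cm_car :> lmodType K;
  cm_d   : cm_car -> cm_car;
  cm_act : nat -> A -> cm_car -> cm_car;
  cm_ax  : conformal_action (@lca_d K A) (@lca_br K A) cm_d cm_act }.

Arguments lca_d {K l}.
Arguments lca_br {K l}.
Arguments cm_d {K A c}.
Arguments cm_act {K A c}.

Lemma linear_at0 (K : fieldType) (U V : lmodType K) (f : U -> V) :
  linear f -> f 0 = 0.
Proof. by move=> /(_ (-1) 0 0); rewrite scaler0 addr0 scaleN1r addNr. Qed.

Section PairLemmas.
Variables (K : fieldType) (V W : lmodType K).

Lemma pair_inj : injective (fun v : V => (v, 0 : W)).
Proof. by move=> u v []. Qed.

Lemma snd_surj (w : W) : exists x : V * W, x.2 = w.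
Proof. by exists (0, w). Qed.

Lemma snd_exact (x : V * W) : x.2 = 0 <-> exists v : V, x = (v, 0).
Proof.
by case: x => v w /=; split => [->|[u [_ ->]] //]; exists v.
Qed.

Lemma pairMn (v : V) (w : W) k : ((v, w) : V * W) *+ k = (v *+ k, w *+ k).
Proof. by elim: k => // k IH; rewrite !mulrS IH. Qed.

End PairLemmas.

Section Modules.
Variables (K : fieldType) (A : lie_conformal K).
Implicit Types (M N V W : conformal_module A).

Definition module_hom M N (f : M -> N) : Prop :=
  [/\ linear f, forall v, f (cm_d v) = cm_d (f v)
    & forall n a v, f (cm_act n a v) = cm_act n a (f v)].

(* 0 -> V -> E -> W -> 0 *)
Record extension W V := Extension {
  ext_mod :> conformal_module A;
  ext_inj : V -> ext_mod;
  ext_prj : ext_mod -> W;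
  ext_inj_hom : module_hom ext_inj;
  ext_prj_hom : module_hom ext_prj;
  ext_injective : injective ext_inj;
  ext_surjective : forall w, exists e, ext_prj e = w;
  ext_exact : forall e, ext_prj e = 0 <-> exists v, e = ext_inj v }.

Arguments ext_inj {W V} _ _.
Arguments ext_prj {W V} _ _.

Definition ext_equiv W V (E E' : extension W V) : Prop :=
  exists psi : E -> E', [/\ module_hom psi,
    forall v, psi (ext_inj E v) = ext_inj E' v
    & forall e, ext_prj E' (psi e) = ext_prj E e].

(* A cocycle z records the V-components of the actions of d and of a_lambda on
   the lift w |-> (0, w) of W to the vector space V * W; for W(b) the second
   component is determined by the actions of L and H. *)
Definition cochain W V : lmodType K :=
  ((W -> V) * (nat -> A -> W -> V))%type.

Section Twisted.
Variables (W V : conformal_module A) (z : cochain W V).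

Definition twisted_d (x : V * W) : V * W := (cm_d x.1 + z.1 x.2, cm_d x.2).

Definition twisted_act (n : nat) (a : A) (x : V * W) : V * W :=
  (cm_act n a x.1 + z.2 n a x.2, cm_act n a x.2).

Definition cocycle : Prop :=
  conformal_action (@lca_d K A) (@lca_br K A) twisted_d twisted_act.

Definition twisted_module (hz : cocycle) : conformal_module A :=
  ConformalModule hz.

Lemma twisted_inj_hom (hz : cocycle) :
  @module_hom V (twisted_module hz) (fun v => (v, 0)).
Proof.
have [dl _ ar _ _ _ _] := cm_ax W.
have [dlV _ arV _ _ _ _] := cm_ax V.
have [hdl _ har _ _ _ _] := hz.
have z10 : z.1 0 = 0.
  by have /(congr1 fst) := linear_at0 hdl; rewrite /= (linear_at0 dlV) add0r.
have z20 n a : z.2 n a 0 = 0.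
  have /(congr1 fst) := linear_at0 (har n a).
  by rewrite /= (linear_at0 (arV n a)) add0r.
split.
- by move=> c u v; congr pair; rewrite /= scaler0 addr0.
- by move=> v; rewrite /= /twisted_d /= z10 addr0 (linear_at0 dl).
- by move=> n a v; rewrite /= /twisted_act /= z20 addr0 (linear_at0 (ar n a)).
Qed.

Lemma twisted_prj_hom (hz : cocycle) :
  @module_hom (twisted_module hz) W snd.
Proof. by split. Qed.

Definition twisted_extension (hz : cocycle) : extension W V :=
  Extension (twisted_inj_hom hz) (twisted_prj_hom hz) (@pair_inj _ V W)
    (@snd_surj _ V W) (@snd_exact _ V W).

End Twisted.

Section DirectSum.
Variables W V : conformal_module A.

Definition dsum_d (x : V * W) : V * W := (cm_d x.1, cm_d x.2).

Definition dsum_act (n : nat) (a : A) (x : V * W) : V * W :=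
  (cm_act n a x.1, cm_act n a x.2).

Lemma dsum_ax :
  conformal_action (@lca_d K A) (@lca_br K A) dsum_d dsum_act.
Proof.
have [dl al ar af adl adr ac] := cm_ax V.
have [dl' al' ar' af' adl' adr' ac'] := cm_ax W.
split.
- by move=> c x y; rewrite /dsum_d /= dl dl'.
- by move=> n v c a a'; rewrite /dsum_act al al'.
- by move=> n a c x y; rewrite /dsum_act /= ar ar'.
- move=> a [v w]; have [N hN] := af a v; have [N' hN'] := af' a w.
  by exists (N + N')%N => n hn; rewrite /dsum_act /= hN ?hN' //; lia.
- by move=> [|n] a x; rewrite /dsum_act adl adl' // /= !oppr0.
- move=> n a x; have := adr n a x.1; have := adr' n a x.2.
  by case: n => [|n] h' h; congr pair; [exact: h|exact: h'|exact: h|exact: h'].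
- move=> m n a b x.
  have -> : bracket_act (@lca_br K A) dsum_act m n a b x =
    (bracket_act (@lca_br K A) cm_act m n a b x.1,
     bracket_act (@lca_br K A) cm_act m n a b x.2).
    rewrite /bracket_act; elim/big_rec3: _ => // j y1 y2 y3 _ ->.
    by rewrite pairMn.
  by rewrite -ac -ac'.
Qed.

Definition dsum_module : conformal_module A := ConformalModule dsum_ax.

Lemma dsum_inj_hom : @module_hom V dsum_module (fun v => (v, 0)).
Proof.
have [dl _ ar _ _ _ _] := cm_ax W; split.
- by move=> c u v; congr pair; rewrite /= scaler0 addr0.
- by move=> v; rewrite /= /dsum_d /= (linear_at0 dl).
- by move=> n a v; rewrite /= /dsum_act /= (linear_at0 (ar n a)).
Qed.

Lemma dsum_prj_hom : @module_hom dsum_module W snd.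
Proof. by split. Qed.

Definition dsum_extension : extension W V :=
  Extension dsum_inj_hom dsum_prj_hom (@pair_inj _ V W)
    (@snd_surj _ V W) (@snd_exact _ V W).

End DirectSum.

Definition ext_trivial W V (E : extension W V) : Prop :=
  ext_equiv E (dsum_extension W V).

Definition coboundary W V (z : cochain W V) : Prop :=
  exists hz : cocycle z, ext_trivial (twisted_extension hz).

(* Ext(W, V) = cocycles / coboundaries has dimension n: it has a basis made of
   the classes of n cocycles e 0, ..., e (n - 1). Lemmas cocycle_linear and
   coboundary_linear below show that both are subspaces of the cochains. *)
Definition Ext_dim W V (n : nat) : Prop :=
  exists e : 'I_n -> cochain W V, (forall i, cocycle (e i)) /\
    forall z, cocycle z ->
      exists! c : 'rV[K]_n, coboundary (z - \sum_i c 0 i *: e i).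

End Modules.

Arguments ext_inj {K A W V} _ _.
Arguments ext_prj {K A W V} _ _.

Section LinearFacts.
Variables (K : fieldType) (U V : lmodType K) (f : U -> V).
Hypothesis hf : linear f.

Lemma linear_atD u v : f (u + v) = f u + f v.
Proof. by have := hf 1 u v; rewrite !scale1r. Qed.

Lemma linear_atZ c u : f (c *: u) = c *: f u.
Proof. by have := hf c u 0; rewrite !addr0 (linear_at0 hf) addr0. Qed.

Lemma linear_atN u : f (- u) = - f u.
Proof. by rewrite -scaleN1r linear_atZ scaleN1r. Qed.

Lemma linear_atMn u k : f (u *+ k) = f u *+ k.
Proof.
by elim: k => [|k IH]; rewrite ?mulr0n ?(linear_at0 hf) // !mulrS linear_atD IH.
Qed.

Lemma linear_at_sum k (F : 'I_k -> U) : f (\sum_i F i) = \sum_i f (F i).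
Proof. by apply: (big_morph f linear_atD (linear_at0 hf)). Qed.

End LinearFacts.

Section ExtSubspaces.
Variables (K : fieldType) (A : lie_conformal K) (W V : conformal_module A).
Implicit Types z : cochain W V.

Definition coc_bracket z m n a b w : V :=
  \sum_(j < m.+1) z.2 (m + n - j)%N (lca_br j a b) w *+ 'C(m + n - j, n).

Record cocycle_eqs z : Prop := CocycleEqs {
  coc_dlin : linear z.1;
  coc_linl : forall n w, linear (fun a => z.2 n a w);
  coc_linr : forall n a, linear (z.2 n a);
  coc_fin  : forall a w, exists N, forall n, (N <= n)%N -> z.2 n a w = 0;
  coc_dl   : forall n a w,
    z.2 n (lca_d a) w = - lam_mul (fun k => z.2 k a w) n;
  coc_dr   : forall n a w,
    (cm_d (z.2 n a w) - cm_act n a (z.1 w)) +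
    (z.1 (cm_act n a w) - z.2 n a (cm_d w)) =
      - lam_mul (fun k => z.2 k a w) n;
  coc_comm : forall m n a b w,
    (cm_act m a (z.2 n b w) - cm_act n b (z.2 m a w)) +
    (z.2 m a (cm_act n b w) - z.2 n b (cm_act m a w)) =
      coc_bracket z m n a b w }.

Lemma twisted_bracket z m n a b (x : V * W) :
  bracket_act (@lca_br K A) (twisted_act z) m n a b x =
  (bracket_act (@lca_br K A) cm_act m n a b x.1 +
   coc_bracket z m n a b x.2,
   bracket_act (@lca_br K A) cm_act m n a b x.2).
Proof.
rewrite /coc_bracket ?/bracket_act -big_split /=; elim/big_rec3: _ => // j y1 y2 y3 _ ->.
by rewrite pairMn mulrnDl.
Qed.

Lemma cocycleP z : cocycle z <-> cocycle_eqs z.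
Proof.
have [dl al ar af adl adr ac] := cm_ax V.
have [dl' al' ar' af' adl' adr' ac'] := cm_ax W.
split=> [[zd zl zr zf zdl zdr zc]|[zd zl zr zf zdl zdr zc]].
  split.
  - move=> c u v; have /(congr1 fst) := zd c (0, u) (0, v).
    by rewrite /= scaler0 add0r (linear_at0 dl) !add0r.
  - move=> n w c a a'; have /(congr1 fst) := zl n (0, w) c a a'.
    by rewrite /= !(linear_at0 (ar _ _)) !add0r.
  - move=> n a c u v; have /(congr1 fst) := zr n a c (0, u) (0, v).
    by rewrite /= scaler0 add0r (linear_at0 (ar _ _)) !add0r.
  - move=> a w; have [N hN] := zf a (0, w); exists N => n /hN /(congr1 fst) /=.
    by rewrite (linear_at0 (ar _ _)) add0r.
  - move=> n a w; have /(congr1 fst) := zdl n a (0, w).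
    rewrite /= (linear_at0 (ar _ _)) add0r => ->.
    by case: n => [|n] //=; rewrite (linear_at0 (ar _ _)) add0r.
  - move=> n a w; have /(congr1 fst) := zdr n a (0, w).
    rewrite /= (linear_at0 dl) (linear_at0 (ar _ _)) !add0r opprD addrACA => ->.
    by case: n => [|n] //=; rewrite (linear_at0 (ar _ _)) add0r.
  - move=> m n a b w; have /(congr1 fst) := zc m n a b (0, w).
    rewrite twisted_bracket /= !(linear_at0 (ar _ _)) !add0r opprD addrACA => ->.
    rewrite -[RHS]add0r; congr (_ + _); rewrite /coc_bracket ?/bracket_act big1 // => j _.
    by rewrite (linear_at0 (ar _ _)) mul0rn.
split.
- move=> c x y; congr pair; last exact: dl'.
  by rewrite /= dl zd scalerDr addrACA.
- move=> n x c a a'; congr pair; last exact: al'.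
  have /= -> := al n x.1 c a a'; have /= -> := zl n x.2 c a a'.
  by rewrite /= scalerDr addrACA.
- move=> n a c x y; congr pair; last exact: ar'.
  by rewrite /= ar zr scalerDr addrACA.
- move=> a [v w]; have [N1 h1] := af a v; have [N2 h2] := af' a w.
  have [N3 h3] := zf a w; exists (N1 + N2 + N3)%N => n hn.
  by rewrite /twisted_act /= h1 ?h2 ?h3 ?addr0 //; lia.
- move=> n a x; rewrite /twisted_act adl zdl adl' -opprD.
  by case: n => [|n] //=; rewrite ?addr0.
- move=> n a [v w].
  transitivity ((- lam_mul (fun k => cm_act k a v) n - lam_mul (fun k => z.2 k a w) n,
     - lam_mul (fun k => cm_act k a w) n) : (V * W)%type).
    congr pair; last exact: adr'.
    rewrite -adr -zdr /= (linear_atD dl) (linear_atD (ar _ _)).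
    by rewrite !opprD !addrA (ACl (1*4*2*5*3*6)).
  by case: n => [|n] //=; rewrite -opprD /= ?addr0.
- move=> m n a b [v w]; rewrite twisted_bracket -zc -ac -ac'; congr pair.
  rewrite /= !(linear_atD (ar _ _)).
  by rewrite !opprD !addrA (ACl (1*4*2*5*3*6)).
Qed.

Lemma cocycle_linear c z z' : cocycle z -> cocycle z' -> cocycle (c *: z + z').
Proof.
move=> /cocycleP [zd zl zr zf zdl zdr zc] /cocycleP [yd yl yr yf ydl ydr yc].
have [dl al ar af adl adr ac] := cm_ax V.
apply/cocycleP; set y := c *: z + z'.
have y1 w : y.1 w = c *: z.1 w + z'.1 w by [].
have y2 n a w : y.2 n a w = c *: z.2 n a w + z'.2 n a w by [].
have sw (k l : K) (u : V) : k *: (l *: u) = l *: (k *: u).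
  by rewrite !scalerA mulrC.
split.
- by move=> k u v; rewrite !y1 zd yd !scalerDr sw addrACA.
- move=> n w k a a'; rewrite !y2.
  have /= -> := zl n w k a a'; have /= -> := yl n w k a a'.
  by rewrite !scalerDr sw addrACA.
- by move=> n a k u v; rewrite !y2 zr yr !scalerDr sw addrACA.
- move=> a w; have [N1 h1] := zf a w; have [N2 h2] := yf a w.
  exists (N1 + N2)%N => n hn.
  by rewrite y2 h1 ?h2 ?scaler0 ?addr0 //; lia.
- move=> n a w; rewrite y2 zdl ydl scalerN -opprD.
  by case: n => [|n] /=; rewrite ?scaler0 ?addr0.
- move=> n a w; rewrite !y1 !y2 dl ar.
  have -> : - lam_mul (fun k => y.2 k a w) n =
    c *: (- lam_mul (fun k => z.2 k a w) n) + - lam_mul (fun k => z'.2 k a w) n.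
    by case: n => [|n]; rewrite /= scalerN -opprD ?scaler0 ?addr0.
  rewrite -zdr -ydr !scalerDr !scalerN !opprD !addrA.
  by rewrite (ACl (1*3*5*7*2*4*6*8)).
- move=> m n a b w; rewrite !y2 !ar.
  have -> : coc_bracket y m n a b w =
    c *: coc_bracket z m n a b w +
    coc_bracket z' m n a b w.
    rewrite /coc_bracket ?/bracket_act scaler_sumr -big_split; apply: eq_bigr => j _.
    by rewrite y2 mulrnDl scalerMnr.
  rewrite -zc -yc !scalerDr !scalerN !opprD !addrA.
  by rewrite (ACl (1*3*5*7*2*4*6*8)).
Qed.

Lemma coboundaryP z : coboundary z <-> cocycle z /\
  exists phi : W -> V, [/\ linear phi,
    forall w, z.1 w = cm_d (phi w) - phi (cm_d w)
  & forall n a w, z.2 n a w = cm_act n a (phi w) - phi (cm_act n a w)].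
Proof.
have [dl al ar af adl adr ac] := cm_ax V.
have [dl' al' ar' af' adl' adr' ac'] := cm_ax W.
split=> [[hz [psi [[pl pd pa] pi pp]]]|[hz [phi [hl hd ha]]]].
  split=> //; exists (fun w => (psi ((0, w) : V * W)%type).1).
  have psiE (v : V) (w : W) : psi (v, w) = (v + (psi ((0, w) : V * W)%type).1, w).
    have /= := pl 1 (v, 0) (0, w); rewrite !scale1r.
    have -> : ((v, 0) : V * W)%type + (0, w) = (v, w).
      by congr pair; rewrite /= ?addr0 ?add0r.
    move=> ->; have /= -> := pi v; have /= := pp (0, w).
    by case: (psi (0, w)) => u u' /= ->; congr pair; rewrite /= add0r.
  have toE (x : V * W) (y : V * W) : x = y -> x.1 = y.1 by move->.
  split.
  - move=> c u v; have /toE /= <- := pl c (0, u) (0, v).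
    congr (psi _).1; congr pair; by rewrite /= scaler0 addr0.
  - move=> w; have /toE /= <- := pd (0, w).
    by rewrite /twisted_d /= psiE /= (linear_at0 dl) add0r addrK.
  - move=> n a w; have /toE /= <- := pa n a (0, w).
    by rewrite /twisted_act /= psiE /= (linear_at0 (ar _ _)) add0r addrK.
exists hz, (fun x : V * W => (x.1 + phi x.2, x.2)); split=> //.
  split.
  - move=> c x y; congr pair; rewrite /= hl scalerDr addrACA; by [].
  - move=> x; congr pair; rewrite /= hd (linear_atD dl) -addrA.
    by rewrite subrK.
  - move=> n a x; congr pair; rewrite /= ha (linear_atD (ar _ _)) -addrA.
    by rewrite subrK.
by move=> v; congr pair; rewrite /= (linear_at0 hl) addr0.
Qed.

Lemma coboundary_linear c z z' :
  coboundary z -> coboundary z' -> coboundary (c *: z + z').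
Proof.
have [dl al ar af adl adr ac] := cm_ax V.
move=> /coboundaryP [hz [phi [hl hd ha]]] /coboundaryP [hz' [phi' [hl' hd' ha']]].
apply/coboundaryP; split; first exact: cocycle_linear.
exists (fun w => c *: phi w + phi' w); split.
- move=> k u v; rewrite hl hl' !scalerDr !scalerA [c * k]mulrC addrACA.
  by [].
- move=> w; have -> : (c *: z + z').1 w = c *: z.1 w + z'.1 w by [].
  by rewrite hd hd' dl scalerDr scalerN opprD addrACA.
- move=> n a w; have -> : (c *: z + z').2 n a w = c *: z.2 n a w + z'.2 n a w by [].
  by rewrite ha ha' ar scalerDr scalerN opprD addrACA.
Qed.

End ExtSubspaces.

Section Generation.
Variables (K : fieldType) (A M : lmodType K).
Variables (dA : A -> A) (br : nat -> A -> A -> A).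
Variables (dM : M -> M) (act : nat -> A -> M -> M).
Hypotheses (brl : forall n b, linear (fun a => br n a b))
  (brr : forall n a, linear (br n a))
  (brdl : forall n a b, br n (dA a) b = - lam_mul (fun k => br k a b) n)
  (brdr : forall n a b,
     dA (br n a b) - br n a (dA b) = - lam_mul (fun k => br k a b) n).
Hypotheses (dlin : linear dM)
  (al : forall n v, linear (fun a => act n a v))
  (ar : forall n a, linear (act n a))
  (adl : forall n a v, act n (dA a) v = - lam_mul (fun k => act k a v) n)
  (adr : forall n a v,
     dM (act n a v) - act n a (dM v) = - lam_mul (fun k => act k a v) n).

Let brdr' n a b : br n a (dA b) = dA (br n a b) + lam_mul (fun k => br k a b) n.
Proof. by rewrite -[lam_mul _ _]opprK -brdr opprB addrC subrK. Qed.

Let adr' n a v : act n a (dM v) = dM (act n a v) + lam_mul (fun k => act k a v) n.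
Proof. by rewrite -[lam_mul _ _]opprK -adr opprB addrC subrK. Qed.

Let alE n c a a' v : act n (c *: a + a') v = c *: act n a v + act n a' v.
Proof. exact: al. Qed.
Let arE n a c v v' : act n a (c *: v + v') = c *: act n a v + act n a v'.
Proof. exact: ar. Qed.
Let brlE n c a a' b : br n (c *: a + a') b = c *: br n a b + br n a' b.
Proof. exact: brl. Qed.
Let brrE n a c b b' : br n a (c *: b + b') = c *: br n a b + br n a b'.
Proof. exact: brr. Qed.
Let al0 n v : act n 0 v = 0.
Proof. exact: (linear_at0 (al n v)). Qed.
Let alN n a v : act n (- a) v = - act n a v.
Proof. exact: (linear_atN (al n v)). Qed.
Let alD n a a' v : act n (a + a') v = act n a v + act n a' v.
Proof. exact: (linear_atD (al n v)). Qed.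

Definition comm_at a b v := forall m n,
  act m a (act n b v) - act n b (act m a v) = bracket_act br act m n a b v.

Lemma comm_at_lin1 b v c a a' :
  comm_at a b v -> comm_at a' b v -> comm_at (c *: a + a') b v.
Proof.
move=> h h' m n; rewrite !alE arE.
rewrite opprD addrACA -scalerN -scalerDr h h' /bracket_act scaler_sumr -big_split.
by apply: eq_bigr => j _ /=; rewrite brlE alE mulrnDl scalerMnr.
Qed.

Lemma comm_at_lin2 a v c b b' :
  comm_at a b v -> comm_at a b' v -> comm_at a (c *: b + b') v.
Proof.
move=> h h' m n; rewrite !alE arE.
rewrite opprD addrACA -scalerN -scalerDr h h' /bracket_act scaler_sumr -big_split.
by apply: eq_bigr => j _ /=; rewrite brrE alE mulrnDl scalerMnr.
Qed.

Lemma comm_at_lin3 a b c v v' :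
  comm_at a b v -> comm_at a b v' -> comm_at a b (c *: v + v').
Proof.
move=> h h' m n; rewrite !arE.
rewrite opprD addrACA -scalerN -scalerDr h h' /bracket_act scaler_sumr -big_split.
by apply: eq_bigr => j _ /=; rewrite arE mulrnDl scalerMnr.
Qed.

Lemma comm_at_d1 a b v : comm_at a b v -> comm_at (dA a) b v.
Proof.
move=> h [|m] n; rewrite !adl /= /bracket_act big_ord_recl /= brdl /= !oppr0.
  by rewrite (linear_at0 (ar n b)) al0 mul0rn big_ord0 subr0 addr0.
rewrite al0 mul0rn add0r (linear_atN (ar n b)) -opprD h -sumrN; apply: eq_bigr => j _.
by rewrite /bump /= brdl /= alN mulNrn addSn.
Qed.

Lemma comm_at_d2 a b v : comm_at a b v -> comm_at a (dA b) v.
Proof.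
move=> h m n; rewrite !adl.
have -> : bracket_act br act m n a (dA b) v =
   \sum_(j < m.+1) (act (m + n - j) (dA (br j a b)) v) *+ 'C(m + n - j, n) +
   \sum_(j < m.+1) (act (m + n - j) (lam_mul (fun k => br k a b) j) v)
      *+ 'C(m + n - j, n).
  rewrite -big_split; apply: eq_bigr => j _ /=.
  by rewrite brdr' alD mulrnDl.
rewrite big_ord_recr /= [X in _ = _ + X]big_ord_recl /=.
rewrite al0 mul0rn add0r addrAC -big_split /= addKn binn.
case: n => [|n]; rewrite !adl /=.
  rewrite oppr0 (linear_at0 (ar _ _)) subr0 addr0 big1 // => j _.
  have hj := ltn_ord j; rewrite addn0 !bin0 adl.
  have -> : (m - j = (m - bump 0 j).+1)%N by rewrite /bump; lia.
  by rewrite /= addNr.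
rewrite (linear_atN (ar _ _)) -opprD h /bracket_act big_ord_recr /= opprD.
rewrite addKn binn mulr1n; congr (_ - _); rewrite -sumrN; apply: eq_bigr => j _.
have hj := ltn_ord j.
have e1 : (m + n.+1 - j = (m + n - j).+1)%N by lia.
have e2 : (m + n.+1 - bump 0 j = m + n - j)%N by rewrite /bump; lia.
rewrite adl e1 e2 /= binS mulrnDr !mulNrn.
by rewrite addrAC addNr add0r.
Qed.

Lemma comm_at_d3 a b v : comm_at a b v -> comm_at a b (dM v).
Proof.
move=> h m n; rewrite !adr' !(linear_atD (ar _ _)) !adr'.
have -> : bracket_act br act m n a b (dM v) = dM (bracket_act br act m n a b v) +
   \sum_(j < m.+1) (lam_mul (fun k => act k (br j a b) v) (m + n - j))
      *+ 'C(m + n - j, n).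
  rewrite /bracket_act (linear_at_sum dlin) -big_split; apply: eq_bigr => j _ /=.
  by rewrite adr' mulrnDl (linear_atMn dlin).
have AC6 (x p q y r s : M) : x + p + q - (y + r + s) = (x - y) + ((p - s) + (q - r)).
  by rewrite !opprD !addrA (ACl (1*4*2*6*3*5)).
rewrite -h (linear_atD dlin) (linear_atN dlin) AC6; congr (_ + _).
case: m n => [|m] [|n] /=.
- by rewrite big_ord1 add0n subn0 /= !(linear_at0 (ar _ _)) !subr0 !addr0 mul0rn.
- rewrite !(linear_at0 (ar _ _)) subr0 add0r h /bracket_act !big_ord1.
  by rewrite !add0n !subn0 !binn.
- rewrite !(linear_at0 (ar _ _)) subr0 addr0 h /bracket_act [RHS]big_ord_recr.
  rewrite /= !addn0 subnn /= mul0rn addr0.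
  apply: eq_bigr => j _; have hj := ltn_ord j.
  by have -> : (m.+1 - j = (m - j).+1)%N by [lia]; rewrite !bin0.
rewrite !h /bracket_act [RHS]big_ord_recr [X in _ + X = _]big_ord_recr /=.
rewrite !addKn /= !binn addrA; congr (_ + _).
rewrite -big_split; apply: eq_bigr => j _ /=; have hj := ltn_ord j.
have -> : (m.+1 + n - j = m + n.+1 - j)%N by lia.
have -> : (m.+1 + n.+1 - j = (m + n.+1 - j).+1)%N by lia.
by rewrite /= binS mulrnDr.
Qed.

End Generation.

Section SkewGeneration.
Variables (K : fieldType) (A : lmodType K).
Variables (dA : A -> A) (br : nat -> A -> A -> A).
Hypotheses (dlin : linear dA)
  (brl : forall n b, linear (fun a => br n a b))
  (brr : forall n a, linear (br n a))
  (brdl : forall n a b, br n (dA a) b = - lam_mul (fun k => br k a b) n)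
  (brdr : forall n a b,
     dA (br n a b) - br n a (dA b) = - lam_mul (fun k => br k a b) n).

Let brdr' n a b : br n a (dA b) = dA (br n a b) + lam_mul (fun k => br k a b) n.
Proof. by rewrite -[lam_mul _ _]opprK -brdr opprB addrC subrK. Qed.

Let brlE n c a a' b : br n (c *: a + a') b = c *: br n a b + br n a' b.
Proof. exact: brl. Qed.
Let brrE n a c b b' : br n a (c *: b + b') = c *: br n a b + br n a b'.
Proof. exact: brr. Qed.

Let sk (Y : nat -> A) n N :=
  \sum_(j < N) (-1) ^+ j *: (iter (j - n) dA (Y j) *+ 'C(j, n)).

Let iter_lin k : linear (iter k dA).
Proof. by elim: k => [|k IH] c u v //=; rewrite IH dlin. Qed.

Let sk_widen Y n N N' : (forall j, (N <= j)%N -> Y j = 0) -> (N <= N')%N ->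
  sk Y n N = sk Y n N'.
Proof.
move=> hY /subnK <-; elim: (N' - N)%N => [//|k IH].
rewrite IH addSn /sk [RHS]big_ord_recr /= hY ?leq_addl //.
by rewrite (linear_at0 (iter_lin _)) mul0rn scaler0 addr0.
Qed.

Definition skew_at a b := exists N, (forall j, (N <= j)%N -> br j b a = 0) /\
  forall n, br n a b = - sk (fun j => br j b a) n N.

Lemma skew_atP : (forall a b, skew_at a b) -> lam_skew dA br.
Proof.
move=> h a b N hN n; have [N' [hN' ->]] := h a b; congr (- _).
case: (leqP N N') => [le|/ltnW le]; last exact: sk_widen.
by apply/esym; apply: sk_widen.
Qed.

Let sk_lin c Y Y' n N : sk (fun j => c *: Y j + Y' j) n N = c *: sk Y n N + sk Y' n N.
Proof.
rewrite /sk scaler_sumr -big_split; apply: eq_bigr => j _ /=.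
by rewrite iter_lin mulrnDl scalerDr !scalerMnr !scalerA [c * _]mulrC.
Qed.

Lemma skew_at_lin1 b c a a' :
  skew_at a b -> skew_at a' b -> skew_at (c *: a + a') b.
Proof.
move=> [N [hN h]] [N' [hN' h']]; exists (N + N')%N; split.
  by move=> j hj; rewrite brrE hN ?hN' ?scaler0 ?addr0 //; lia.
move=> n; rewrite brlE h h'.
rewrite (sk_widen _ hN (leq_addr N' N)) (sk_widen _ hN' (leq_addl N N')).
rewrite scalerN -opprD -sk_lin; congr (- _); apply: eq_bigr => j _.
by rewrite brrE.
Qed.

Lemma skew_at_lin2 a c b b' :
  skew_at a b -> skew_at a b' -> skew_at a (c *: b + b').
Proof.
move=> [N [hN h]] [N' [hN' h']]; exists (N + N')%N; split.
  by move=> j hj; rewrite brlE hN ?hN' ?scaler0 ?addr0 //; lia.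
move=> n; rewrite brrE h h'.
rewrite (sk_widen _ hN (leq_addr N' N)) (sk_widen _ hN' (leq_addl N N')).
rewrite scalerN -opprD -sk_lin; congr (- _); apply: eq_bigr => j _.
by rewrite brlE.
Qed.

Let sk_shift (Y : nat -> A) n N :
  sk (lam_mul Y) n N.+1 =
  - (lam_mul (fun k => sk Y k N) n +
     \sum_(j < N) (-1) ^+ j *: (dA (iter (j - n) dA (Y j)) *+ 'C(j, n))).
Proof.
rewrite /sk big_ord_recl sub0n /= mul0rn scaler0 add0r.
case: n => [|n] /=.
  rewrite add0r -sumrN; apply: eq_bigr => j _.
  by rewrite /bump add1n exprS mulN1r scaleNr !bin0 !subn0.
rewrite -big_split -sumrN; apply: eq_bigr => j _ /=.
rewrite /bump add1n exprS mulN1r scaleNr subSS binS mulrnDr -scalerDr addrC.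
congr (- (_ *: (_ + _))).
case: (ltnP n j) => hj; last by rewrite bin_small ?mulr0n //; lia.
by rewrite -iterS; congr (iter _ _ _ *+ _); lia.
Qed.

Let dsk Y n N : dA (sk Y n N) =
  \sum_(j < N) (-1) ^+ j *: (dA (iter (j - n) dA (Y j)) *+ 'C(j, n)).
Proof.
rewrite /sk (linear_at_sum dlin); apply: eq_bigr => j _.
by rewrite (linear_atZ dlin) (linear_atMn dlin).
Qed.

Lemma skew_at_d1 a b : skew_at a b -> skew_at (dA a) b.
Proof.
move=> [N [hN h]]; exists N.+1; split.
  move=> j hj; rewrite brdr' hN ?(linear_at0 dlin) ?add0r; last exact: ltnW.
  by case: j hj => //= j hj; rewrite hN.
move=> n; rewrite brdl.
have -> : sk (fun j => br j b (dA a)) n N.+1 =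
  sk (fun j => dA (br j b a)) n N + sk (lam_mul (fun j => br j b a)) n N.+1.
  rewrite (@sk_widen (fun j => dA (br j b a)) n N N.+1) //; last first.
    by move=> j hj; rewrite hN // (linear_at0 dlin).
  rewrite /sk -big_split; apply: eq_bigr => j _ /=.
  by rewrite brdr' (linear_atD (iter_lin _)) mulrnDl scalerDr.
rewrite sk_shift; set S := \sum_(j < N) _.
have -> : sk (fun j => dA (br j b a)) n N = S.
  by apply: eq_bigr => j _; rewrite -iterSr.
rewrite opprD opprK addrCA addNr addr0.
by case: n {S} => [|n] /=; rewrite ?oppr0 // h opprK.
Qed.

Lemma skew_at_d2 a b : skew_at a b -> skew_at a (dA b).
Proof.
move=> [N [hN h]]; exists N.+1; split.
  by case=> // j hj; rewrite brdl /= hN ?oppr0.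
move=> n; rewrite brdr'.
have -> : sk (fun j => br j (dA b) a) n N.+1 =
  - sk (lam_mul (fun j => br j b a)) n N.+1.
  rewrite /sk -sumrN; apply: eq_bigr => j _ /=.
  by rewrite brdl (linear_atN (iter_lin _)) mulNrn scalerN.
rewrite sk_shift -(dsk (fun j => br j b a)) opprK h (linear_atN dlin) opprD addrC; congr (_ - _).
by case: n => [|n] /=; rewrite ?oppr0 // h.
Qed.

End SkewGeneration.

Section LambdaProduct.
Variable K : fieldType.
Implicit Types (f g h : {poly K}) (q : {poly {poly K}}).

(* In {poly {poly K}} the inner variable 'X%:P is d and the outer variable 'X
   is lambda: these are f(- lambda) and f(d + lambda). *)
Definition at_neg_lam f : {poly {poly K}} := f^:P \Po (- 'X).
Definition at_d_lam f : {poly {poly K}} := f^:P \Po ('X%:P + 'X).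

(* If u_lambda v = q(d, lambda) w, then
   (f(d) u)_lambda (g(d) v) = f(- lambda) g(d + lambda) q(d, lambda) w;
   this is the coefficient of lambda^n. *)
Definition lam_ext q (n : nat) f g : {poly K} :=
  (at_neg_lam f * at_d_lam g * q)`_n.

Let pscale (c : K) q n : (c%:P *: q)`_n = c *: q`_n.
Proof. by rewrite coefZ mul_polyC. Qed.

Lemma lam_extl q n g : linear (fun f => lam_ext q n f g).
Proof.
move=> c f f'; rewrite /lam_ext /at_neg_lam rmorphD /= map_polyZ /=.
by rewrite comp_polyD comp_polyZ !mulrDl -!scalerAl coefD pscale.
Qed.

Lemma lam_extr q n f : linear (lam_ext q n f).
Proof.
move=> c g g'; rewrite /lam_ext /at_d_lam rmorphD /= map_polyZ /=.
rewrite comp_polyD comp_polyZ mulrDr mulrDl -scalerAr -scalerAl.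
by rewrite coefD pscale.
Qed.

Lemma lam_ext_dl q n f g :
  lam_ext q n ('X * f) g = - lam_mul (fun k => lam_ext q k f g) n.
Proof.
rewrite /lam_ext /at_neg_lam rmorphM /= map_polyX comp_polyM comp_polyX.
rewrite !mulNr coefN -!mulrA coefXM.
by case: n => [|n] //=; rewrite !mulrA.
Qed.

Lemma lam_ext_dr q n f g :
  'X * lam_ext q n f g - lam_ext q n f ('X * g) =
  - lam_mul (fun k => lam_ext q k f g) n.
Proof.
rewrite /lam_ext /at_d_lam rmorphM /= map_polyX comp_polyM comp_polyX.
have -> (x y z : {poly {poly K}}) : x * (('X%:P + 'X) * y) * z =
  'X%:P * (x * y * z) + 'X * (x * y * z) by ring.
rewrite coefD coefCM coefXM opprD addNKr.
by case: n.
Qed.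

Lemma lam_ext_fin q f g : exists N, forall n, (N <= n)%N -> lam_ext q n f g = 0.
Proof.
exists (size (at_neg_lam f * at_d_lam g * q)) => n hn.
by rewrite /lam_ext nth_default.
Qed.

Lemma lam_ext0l q n g : lam_ext q n 0 g = 0.
Proof. exact: (linear_at0 (lam_extl q n g)). Qed.

Lemma lam_ext0r q n f : lam_ext q n f 0 = 0.
Proof. exact: (linear_at0 (lam_extr q n f)). Qed.

Lemma lam_ext11 q n : lam_ext q n 1 1 = q`_n.
Proof. by rewrite /lam_ext /at_neg_lam /at_d_lam rmorph1 !comp_polyC !mul1r. Qed.

Definition qlin (c0 c1 d : K) : {poly {poly K}} :=
  (c0%:P + c1%:P * 'X)%:P + d%:P *: 'X.

Definition qcoef (c0 c1 d : K) (n : nat) : {poly K} :=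
  match n with 0%N => c0%:P + c1%:P * 'X | 1%N => d%:P | _ => 0 end.

Lemma qlinE c0 c1 d n : (qlin c0 c1 d)`_n = qcoef c0 c1 d n.
Proof.
rewrite coefD coefC coefZ coefX; case: n => [|[|n]] /=.
- by rewrite mulr0 addr0.
- by rewrite mulr1 add0r.
- by rewrite mulr0 addr0.
Qed.

Lemma lam_ext_lin q n (x0 x1 y0 y1 : K) :
  lam_ext q n (x0%:P + x1%:P * 'X) (y0%:P + y1%:P * 'X) =
  (x0 * y0)%:P * q`_n + (x0 * y1)%:P * ('X * q`_n + lam_mul (nth 0 q) n)
  - (x1 * y0)%:P * lam_mul (nth 0 q) n
  - (x1 * y1)%:P * ('X * lam_mul (nth 0 q) n + lam_mul (lam_mul (nth 0 q)) n).
Proof.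
have L (c0 c1 : K) : c0%:P + c1%:P * 'X = c1 *: ('X * 1) + (c0 *: 1 + 0) :> {poly K}.
  by rewrite addr0 mulr1 mul_polyC alg_polyC addrC.
have el k c f f' g :
  lam_ext q k (c *: f + f') g = c *: lam_ext q k f g + lam_ext q k f' g.
  exact: lam_extl.
have dr k f g : lam_ext q k f ('X * g) =
    'X * lam_ext q k f g + lam_mul (fun k => lam_ext q k f g) k.
  by rewrite -[lam_mul _ _]opprK -lam_ext_dr opprB addrC subrK.
have E k : lam_ext q k 1 1 = q`_k by exact: lam_ext11.
set Y := y0%:P + y1%:P * 'X.
have F k : lam_ext q k 1 Y =
  y1%:P * ('X * q`_k + lam_mul (nth 0 q) k) + y0%:P * q`_k.
  rewrite /Y L !lam_extr lam_ext0r addr0 dr E -!mul_polyC.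
  by congr (_ * (_ + _) + _); case: k => //= k; rewrite E.
rewrite (L x0) !el lam_ext0l lam_ext_dl.
rewrite F -!mul_polyC !polyCM addr0.
case: n => [|n] /=; first by ring.
by rewrite F; ring.
Qed.

Lemma lam_ext1 q n (y0 y1 : K) : lam_ext q n 1 (y0%:P + y1%:P * 'X) =
  y0%:P * q`_n + y1%:P * ('X * q`_n + lam_mul (nth 0 q) n).
Proof.
have := lam_ext_lin q n 1 0 y0 y1.
by rewrite !mul0r !mul1r addr0 !subr0.
Qed.

Lemma lam_extX1 q n (x0 x1 : K) : lam_ext q n (x0%:P + x1%:P * 'X) 1 =
  x0%:P * q`_n - x1%:P * lam_mul (nth 0 q) n.
Proof.
have := lam_ext_lin q n x0 x1 1 0.
by rewrite !mulr0 !mulr1 !mul0r !addr0 subr0.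
Qed.

Lemma lam_extC1 q n (x0 : K) : lam_ext q n x0%:P 1 = x0%:P * q`_n.
Proof.
have := lam_extX1 q n x0 0.
by rewrite !mul0r addr0 subr0.
Qed.

End LambdaProduct.

Section Wb.
Variables (K : fieldType) (b : K).
Implicit Types (f g h : {poly K}).

(* (f, g) stands for f(d) L + g(d) H. *)
Definition W_car : lmodType K := ({poly K} * {poly K})%type.

Definition W_d (x : W_car) : W_car := ('X * x.1, 'X * x.2).

(* [H_lambda L] = - [L_{-lambda-d} H] = ((1 - b) lambda - b d) H. *)
Definition W_br (n : nat) (x y : W_car) : W_car :=
  (lam_ext ('X%:P + 2%:R *: 'X) n x.1 y.1,
   lam_ext ('X%:P + (1 - b)%:P *: 'X) n x.1 y.2 +
   lam_ext ((1 - b)%:P *: 'X - (b *: 'X)%:P) n x.2 y.1).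

Let qLL : 'X%:P + 2%:R *: 'X = qlin 0 1 2%:R :> {poly {poly K}}.
Proof. by rewrite /qlin add0r mul1r polyC_natr. Qed.

Let qLH : 'X%:P + (1 - b)%:P *: 'X = qlin 0 1 (1 - b) :> {poly {poly K}}.
Proof. by rewrite /qlin add0r mul1r. Qed.

Let qHL : (1 - b)%:P *: 'X - (b *: 'X)%:P = qlin 0 (- b) (1 - b).
Proof. by rewrite /qlin add0r mul_polyC scaleNr polyCN addrC. Qed.

Lemma W_ind (P : W_car -> Prop) :
  (forall c u v, P u -> P v -> P (c *: u + v)) -> (forall u, P u -> P (W_d u)) ->
  P (1, 0) -> P (0, 1) -> forall u, P u.
Proof.
move=> hl hd hL hH.
have h0 : P 0 by have := hl (-1) _ _ hL hL; rewrite scaleN1r addNr.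
have h1 f : P (f, 0).
  elim/poly_ind: f => [//|f c /hd IH].
  have := hl c _ _ hL IH; congr P; congr pair.
    by rewrite /= mulrC addrC alg_polyC.
  by rewrite /= scaler0 mulr0 addr0.
have h2 g : P (0, g).
  elim/poly_ind: g => [//|f c /hd IH].
  have := hl c _ _ hH IH; congr P; congr pair.
    by rewrite /= scaler0 mulr0 addr0.
  by rewrite /= mulrC addrC alg_polyC.
move=> [f g]; have := hl 1 _ _ (h1 f) (h2 g).
by congr P; congr pair; rewrite /= scale1r ?addr0 ?add0r.
Qed.

Lemma W_brl n y : linear (fun x => W_br n x y).
Proof.
move=> c x x'; congr pair; rewrite /= !lam_extl //.
by rewrite scalerDr addrACA.
Qed.

Lemma W_brr n x : linear (W_br n x).
Proof.
move=> c y y'; congr pair; rewrite /= !lam_extr //.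
by rewrite scalerDr addrACA.
Qed.

Lemma W_brdl n x y : W_br n (W_d x) y = - lam_mul (fun k => W_br k x y) n.
Proof.
rewrite /W_br /= !lam_ext_dl -opprD.
by case: n => [|n] //=; rewrite addr0.
Qed.

Lemma W_brdr n x y :
  W_d (W_br n x y) - W_br n x (W_d y) = - lam_mul (fun k => W_br k x y) n.
Proof.
transitivity ((- lam_mul (fun k => (W_br k x y).1) n,
               - lam_mul (fun k => (W_br k x y).2) n) : W_car).
  congr pair; first exact: lam_ext_dr.
  rewrite /= mulrDr opprD addrACA !lam_ext_dr -opprD.
  by case: n => [|n] //=; rewrite addr0.
by case: n.
Qed.

Lemma W_d_lin : linear W_d.
Proof. by move=> c x y; congr pair; rewrite /= mulrDr -scalerAr. Qed.

Lemma W_skew : lam_skew W_d W_br.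
Proof.
apply: (skew_atP W_d_lin).
have d1 := skew_at_d1 W_d_lin W_brdl W_brdr.
have d2 := skew_at_d2 W_d_lin W_brdl W_brdr.
have l1 := skew_at_lin1 W_d_lin W_brl W_brr.
have l2 := skew_at_lin2 W_d_lin W_brl W_brr.
have base x y : (x = (1, 0) \/ x = (0, 1)) -> (y = (1, 0) \/ y = (0, 1)) ->
    skew_at W_d W_br x y.
  move=> hx hy; exists 2; split=> [[|[|j]] // _|n].
    case: hx hy => -> [] ->;
    by rewrite /W_br /= qLL qLH qHL ?lam_ext0l ?lam_ext0r ?lam_ext11 ?lam_ext0l ?qlinE ?addr0 ?add0r.
  rewrite 2!big_ord_recl big_ord0 /bump /=.
  case: hx hy => -> [] ->; case: n => [|[|n]];
    rewrite /W_br /= ?qLL ?qLH ?qHL ?lam_ext0l ?lam_ext0r ?lam_ext11 ?lam_ext0l ?qlinE /=;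
    congr pair; rewrite /= ?bin0 ?binn ?bin_small //= ?mulr0n ?mulr1n -?mul_polyC ?(mulr0, addr0,scaler0); ring.
have gen x : (x = (1, 0) \/ x = (0, 1)) -> forall y, skew_at W_d W_br x y.
  move=> hx y; elim/W_ind: y => [c u v hu hv|u hu||].
  - exact: l2.
  - exact: d2.
  - by apply: base => //; left.
  - by apply: base => //; right.
move=> x y; elim/W_ind: x => [c u v hu hv|u hu||].
- exact: l1.
- exact: d1.
- by apply: gen; left.
- by apply: gen; right.
Qed.

(* Only the coefficients 0 and 1 of the brackets of L and H are nonzero. *)
Lemma bracket_act2 (M : lmodType K) (act : nat -> W_car -> M -> M) m n x y v :
  (forall k, act k 0 v = 0) -> (forall j, W_br j.+2 x y = 0) ->
  bracket_act W_br act m n x y v =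
  act (m + n)%N (W_br 0 x y) v *+ 'C(m + n, n) +
  (if m is m'.+1 then act (m' + n)%N (W_br 1 x y) v *+ 'C(m' + n, n) else 0).
Proof.
move=> h0 h2; rewrite /bracket_act big_ord_recl subn0; congr (_ + _).
case: m => [|m]; first by rewrite big_ord0.
rewrite big_ord_recl big1 => [|j _]; last by rewrite /bump /= h2 h0 mul0rn.
by rewrite addr0 /= addSn subSS subn0.
Qed.

Lemma W_br_gen2 x y j : (x = (1, 0) \/ x = (0, 1)) -> (y = (1, 0) \/ y = (0, 1)) ->
  W_br j.+2 x y = 0.
Proof.
by case=> -> [] ->; rewrite /W_br /= ?qLL ?qLH ?qHL ?lam_ext0l ?lam_ext0r
  ?lam_ext11 ?lam_ext0l ?qlinE ?addr0 ?add0r.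
Qed.

Lemma W_adj : conformal_action W_d W_br W_d W_br.
Proof.
split; [exact: W_d_lin|exact: W_brl|exact: W_brr| |exact: W_brdl|exact: W_brdr|].
  move=> x y.
  have [N1 h1] := lam_ext_fin ('X%:P + 2%:R *: 'X) x.1 y.1.
  have [N2 h2] := lam_ext_fin ('X%:P + (1 - b)%:P *: 'X) x.1 y.2.
  have [N3 h3] := lam_ext_fin ((1 - b)%:P *: 'X - (b *: 'X)%:P) x.2 y.1.
  exists (N1 + N2 + N3)%N => n hn; rewrite /W_br h1 ?h2 ?h3 ?addr0 //; lia.
suff h x y v : comm_at W_br W_br x y v by move=> m n x y v; exact: h.
have l1 := comm_at_lin1 W_brl W_brl W_brr.
have l2 := comm_at_lin2 W_brr W_brl W_brr.
have l3 := comm_at_lin3 (br := W_br) W_brr.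
have d1 := comm_at_d1 W_brdl W_brl W_brr W_brdl.
have d2 := comm_at_d2 W_brdr W_brl W_brr W_brdl.
have d3 := comm_at_d3 (br := W_br) W_d_lin W_brr W_brdr.
have base x' y' v' : (x' = (1, 0) \/ x' = (0, 1)) -> (y' = (1, 0) \/ y' = (0, 1)) ->
    (v' = (1, 0) \/ v' = (0, 1)) -> comm_at W_br W_br x' y' v'.
  move=> hx hy hv m n; rewrite bracket_act2; last 2 first.
  - by move=> k; exact: (linear_at0 (W_brl k _)).
  - by move=> j; exact: W_br_gen2.
  have pM (u w : {poly K}) k : ((u, w) : W_car) *+ k = (u *+ k, w *+ k) by exact: pairMn.
  have Q c0 c1 d k : qcoef c0 c1 d k =
     (match k with 0 => c0 | 1 => d | _ => 0 end)%:P
       + (match k with 0 => c1 | _ => 0 end)%:P * 'X :> {poly K}.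
    by case: k => [|[|k]] //=; rewrite ?mul0r ?addr0.
  case: hx hy hv => -> [] -> [] ->; rewrite /W_br /= ?qLL ?qLH ?qHL
    ?(lam_ext0l, lam_ext0r, subr0, oppr0, add0r, addr0, lam_ext11, qlinE);
    rewrite ?[qcoef _ _ _ 0]/= ?[qcoef _ _ _ 1]/=
      ?[in X in X - _]Q ?[in X in _ - X]Q ?lam_ext1 ?lam_extX1 ?lam_extC1 ?qlinE;
    case: m n => [|[|m]] [|[|n]];
    congr pair; rewrite /= ?pM /= ?qlinE /= ?addnS ?addSn ?addn0 ?add0n /= ?lam_extX1 ?lam_extC1 ?qlinE /= ?bin0 ?binn ?bin1 ?mulr1n ?mul0r ?mulr0 ?addr0 ?add0r ?subr0 ?mul0rn ?oppr0 ?(lam_ext0l, lam_ext0r, mul0rn, add0r) //.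
  all: try ring.
have gen x' y' : (x' = (1, 0) \/ x' = (0, 1)) -> (y' = (1, 0) \/ y' = (0, 1)) ->
    comm_at W_br W_br x' y' v.
  move=> hx hy; elim/W_ind: v => [c u u' hu hu'|u hu||].
  - exact: l3.
  - exact: d3.
  - by apply: base => //; left.
  - by apply: base => //; right.
have gen' x' : (x' = (1, 0) \/ x' = (0, 1)) -> comm_at W_br W_br x' y v.
  move=> hx; elim/W_ind: y => [c u u' hu hu'|u hu||].
  - exact: l2.
  - exact: d2.
  - by apply: gen => //; left.
  - by apply: gen => //; right.
elim/W_ind: x => [c u u' hu hu'|u hu||].
- exact: l1.
- exact: d1.
- by apply: gen'; left.
- by apply: gen'; right.
Qed.

Section RankOne.
Variables alpha Delta : K.

Definition M_d (h : {poly K}) : {poly K} := 'X * h.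

Definition M_act (n : nat) (x : W_car) (h : {poly K}) : {poly K} :=
  lam_ext (('X + alpha%:P)%:P + Delta%:P *: 'X) n x.1 h.

Let qM : ('X + alpha%:P)%:P + Delta%:P *: 'X = qlin alpha 1 Delta.
Proof. by rewrite /qlin mul1r [X in X%:P]addrC. Qed.

Lemma M_d_lin : linear M_d.
Proof. by move=> c x y; rewrite /M_d mulrDr -scalerAr. Qed.

Lemma M_ax : conformal_action W_d W_br M_d M_act.
Proof.
have al n v : linear (fun x => M_act n x v).
  by move=> c x y; rewrite /M_act /= lam_extl.
have ar n x : linear (M_act n x) by exact: lam_extr.
have adl n x v : M_act n (W_d x) v = - lam_mul (fun k => M_act k x v) n.
  exact: lam_ext_dl.
have adr n x v : M_d (M_act n x v) - M_act n x (M_d v) =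
  - lam_mul (fun k => M_act k x v) n by exact: lam_ext_dr.
split=> //; first exact: M_d_lin.
  by move=> x v; exact: lam_ext_fin.
suff h x y v : comm_at W_br M_act x y v by move=> m n x y v; exact: h.
have l1 := comm_at_lin1 W_brl al ar.
have l2 := comm_at_lin2 W_brr al ar.
have l3 := comm_at_lin3 (br := W_br) ar.
have d1 := comm_at_d1 W_brdl al ar adl.
have d2 := comm_at_d2 W_brdr al ar adl.
have d3 := comm_at_d3 (br := W_br) M_d_lin ar adr.
have base x' y' : (x' = (1, 0) \/ x' = (0, 1)) -> (y' = (1, 0) \/ y' = (0, 1)) ->
    comm_at W_br M_act x' y' 1.
  move=> hx hy m n; rewrite bracket_act2; last 2 first.
  - by move=> k; rewrite /M_act /= lam_ext0l.
  - by move=> j; exact: W_br_gen2.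
  have X1 : 1 = 1%:P + 0%:P * 'X :> {poly K} by rewrite mul0r addr0.
  case: hx hy => -> [] ->; rewrite /M_act /W_br /= ?(lam_ext0l, lam_ext0r, mul0rn, subr0, oppr0, add0r);
    try by case: m => [|m]; rewrite ?(lam_ext0l, lam_ext0r, mul0rn, subr0, oppr0, add0r).
  have C k : (lam_ext (('X + alpha%:P)%:P + Delta%:P *: 'X) k 1 1) = qcoef alpha 1 Delta k.
    by rewrite lam_ext11 qM qlinE.
  rewrite !C qM qLL !lam_ext11 !qlinE.
  have Q k : (qcoef alpha 1 Delta k) =
     (match k with 0 => alpha | 1 => Delta | _ => 0 end)%:P + (k == 0%N)%:R%:P * 'X.
    by case: k => [|[|k]] //=; rewrite ?mul1r ?mul0r ?addr0.
  rewrite !Q !lam_ext1.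
  rewrite [qcoef 0 1 2%:R 0]/= lam_extX1.
  rewrite [qcoef 0 1 2%:R 1]/=.
  case: m n => [|[|m]] [|[|n]]; rewrite ?lam_extC1 ?qlinE /= ?qlinE /= ?addnS ?addSn ?addn0 ?add0n /= ?qlinE /= ?bin0 ?binn ?bin1 ?mulr1n ?mul0r ?mulr0 ?addr0 ?add0r ?subr0 ?mul0rn ?oppr0; try ring.
have gen x' y' : (x' = (1, 0) \/ x' = (0, 1)) -> (y' = (1, 0) \/ y' = (0, 1)) ->
    comm_at W_br M_act x' y' v.
  move=> hx hy; elim/poly_ind: v => [|v c hv].
    move=> m n; rewrite /bracket_act !(linear_at0 (ar _ _)) subr0.
    by rewrite big1 // => j _; rewrite (linear_at0 (ar _ _)) mul0rn.
  rewrite mulrC addrC -alg_polyC; apply: l3; [exact: base|exact: d3].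
have gen' x' : (x' = (1, 0) \/ x' = (0, 1)) -> comm_at W_br M_act x' y v.
  move=> hx; elim/W_ind: y => [c u u' hu hu'|u hu||].
  - exact: l2.
  - exact: d2.
  - by apply: gen => //; left.
  - by apply: gen => //; right.
elim/W_ind: x => [c u u' hu hu'|u hu||].
- exact: l1.
- exact: d1.
- by apply: gen'; left.
- by apply: gen'; right.
Qed.

End RankOne.

Definition W_lca : lie_conformal K := LieConformal W_adj W_skew.

Definition W_L : W_lca := (1, 0).
Definition W_H : W_lca := (0, 1).

(* M(alpha, Delta): the polynomial h stands for h(d) v_Delta. *)
Definition M_mod (alpha Delta : K) : conformal_module W_lca :=
  @ConformalModule K W_lca {poly K} M_d (M_act alpha Delta) (M_ax alpha Delta).

Section OneDimensional.
Variable gamma : K.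

Definition C_d (x : K^o) : K^o := gamma *: x.

Definition C_act (n : nat) (a : W_car) (x : K^o) : K^o := 0.

Lemma C_ax : conformal_action W_d W_br C_d C_act.
Proof.
split=> //.
- by move=> c x y; rewrite /C_d scalerDr !scalerA mulrC.
- by move=> n v c x y; rewrite /C_act scaler0 addr0.
- by move=> n a c x y; rewrite /C_act scaler0 addr0.
- by exists 0.
- by case=> [|n] a v; rewrite /C_act /= oppr0.
- by case=> [|n] a v; rewrite /C_act /C_d scaler0 subr0 /= oppr0.
- move=> m n a b' v; rewrite /C_act subr0 /bracket_act big1 // => j _.
  by rewrite mul0rn.
Qed.

Definition C_mod : conformal_module W_lca :=
  @ConformalModule K W_lca K^o C_d C_act C_ax.

End OneDimensional.

(* E = C[d] v_Delta (+) C c_gamma with L_lambda c = a v_Delta, H_lambda c = 0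
   and d c = gamma c + a v_Delta: the decomposition of the vector space E holds
   for any lift c of the generator 1 of C c_gamma, by exactness. *)
Definition given_by (alpha Delta gamma : K)
    (E : extension (C_mod gamma) (M_mod alpha Delta)) (a : K) : Prop :=
  exists c : E, [/\ ext_prj E c = 1,
    forall n, cm_act n W_L c = if n == 0%N then ext_inj E a%:P else 0,
    forall n, cm_act n W_H c = 0
  & cm_d c = gamma *: c + ext_inj E a%:P].

End Wb.

(* Main.v *)
(* Let c be a lift of the generator of C c_gamma. Subtracting from c a multiple
   of v_Delta one gets d c = gamma c + a v_Delta with a constant, namely the
   value at gamma of the polynomial d c - gamma c. Writing
   L_lambda c = f(d, lambda) v_Delta and H_lambda c = g(d, lambda) v_Delta, the
   relation [d, x_lambda] = - lambda x_lambda becomes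
     (d + lambda - gamma) f = a (d + alpha + Delta lambda),
     (d + lambda - gamma) g = 0,
   so that g = 0, f = a, and a = 0 unless alpha + gamma = 0 and Delta = 1. The
   constant a does not depend on the lift and determines the extension.
   Conversely, a = 1 is realized by M(alpha, 0): the vector (d + alpha) v_0
   generates a copy of M(alpha, 1) in it, with quotient C c_{-alpha}. *)
Require Import Defs.
From mathcomp Require Import all_boot all_order all_algebra.
From mathcomp Require Import complex.
From mathcomp Require Import reals.
From mathcomp Require Import ring.

Import GRing.Theory.
Local Open Scope ring_scope.

(** An injective linear intertwiner [f] reflects every axiom, each being an equality between
    vectors. A twisted module can thus be checked inside a known module, with no bracket to
    compute. *)
Lemma conformal_action_inj (K : fieldType) (A M N : lmodType K)
    (dA : A -> A) (br : nat -> A -> A -> A)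
    (dM : M -> M) (actM : nat -> A -> M -> M)
    (dN : N -> N) (actN : nat -> A -> N -> N) (f : N -> M) :
  linear f -> injective f -> (forall v, f (dN v) = dM (f v)) ->
  (forall n a v, f (actN n a v) = actM n a (f v)) ->
  conformal_action dA br dM actM -> conformal_action dA br dN actN.
Proof.
move=> fl fi fd fa [dl al ar af adl adr ac].
have flam a v n : f (lam_mul (fun k => actN k a v) n) =
    lam_mul (fun k => actM k a (f v)) n.
  by case: n => [|n] /=; rewrite ?(linear_at0 fl).
split.
- by move=> c u v; apply: fi; rewrite fd !fl !fd dl.
- by move=> n v c a a'; apply: fi; rewrite fa fl !fa; exact: al.
- by move=> n a c u v; apply: fi; rewrite fa !fl !fa ar.
- move=> a v; have [k hk] := af a (f v); exists k => n /hk h.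
  by apply: fi; rewrite fa h (linear_at0 fl).
- by move=> n a v; apply: fi; rewrite fa (linear_atN fl) flam adl.
- move=> n a v; apply: fi.
  by rewrite (linear_atD fl) !(linear_atN fl) flam fd !fa fd adr.
- move=> m n a b v; apply: fi; rewrite (linear_atD fl) (linear_atN fl) !fa ac.
  rewrite /bracket_act (linear_at_sum fl); apply: eq_bigr => j _.
  by rewrite (linear_atMn fl) fa.
Qed.

Lemma lam_ext1C (K : fieldType) (q : {poly {poly K}}) n (a : K) :
  lam_ext q n 1 a%:P = a%:P * q`_n.
Proof. by have := lam_ext1 q n a 0; rewrite !mul0r !addr0. Qed.

(** * Lifts of the generator and the constant [a] *)

Section Extensions.
Variables (K : fieldType) (b alpha gamma Delta : K).
Local Notation C := (C_mod b gamma).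
Local Notation M := (M_mod b alpha Delta).
Local Notation L := (W_L b).
Local Notation H := (W_H b).
Implicit Types E : extension C M.

Lemma M_actL n (a : K) :
  M_act alpha Delta n (1, 0) a%:P = a%:P * qcoef alpha 1 Delta n.
Proof.
rewrite /M_act /= lam_ext1C -qlinE /qlin; congr (_ * (_%:P + _)`_n).
by rewrite mul1r addrC.
Qed.

Lemma M_actH n (h : {poly K}) : M_act alpha Delta n (0, 1) h = 0.
Proof. exact: lam_ext0l. Qed.

Lemma ext_prj_inj E (h : M) : ext_prj E (ext_inj E h) = 0.
Proof. by apply/ext_exact; exists h. Qed.

Lemma ext_lift_poly E : exists2 c : E, ext_prj E c = 1 &
  exists a : K, cm_d c = gamma *: c + ext_inj E a%:P.
Proof.
have [il id _] := ext_inj_hom E; have [pl pd _] := ext_prj_hom E.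
have [dl _ _ _ _ _ _] := cm_ax E.
have [c0 c01] := ext_surjective E 1.
have [p hp] : exists p : M, cm_d c0 - gamma *: c0 = ext_inj E p.
  apply/ext_exact; rewrite (linear_atD pl) (linear_atN pl) (linear_atZ pl) pd.
  by rewrite c01 subrr.
(* Division of [p] by d - gamma: correcting the lift by the quotient [q] leaves only the remainder
   p(gamma). *)
have /factor_theorem [q hq] : root ((p : {poly K}) - p.[gamma]%:P) gamma.
  by rewrite /root !hornerE subrr.
exists (c0 - ext_inj E q).
  by rewrite (linear_atD pl) (linear_atN pl) ext_prj_inj subr0.
exists p.[gamma]; rewrite (linear_atD dl) (linear_atN dl) -id.
have -> : cm_d c0 = gamma *: c0 + ext_inj E p by rewrite -hp addrC subrK.
have -> : p.[gamma]%:P = p - cm_d (q : M) + gamma *: (q : M) :> M.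
  rewrite /= /M_d -(mul_polyC gamma q).
  have -> : 'X * q = q * ('X - gamma%:P) + gamma%:P * q by ring.
  rewrite -hq; ring.
rewrite !(linear_atD il) (linear_atN il) (linear_atZ il) scalerBr.
by rewrite [RHS]addrACA addNr addr0 addrA.
Qed.

Lemma act_lift_poly E (c : E) (x : W_lca b) : ext_prj E c = 1 ->
  exists f : nat -> M, forall n, cm_act n x c = ext_inj E (f n).
Proof.
move=> c1; have [_ _ pa] := ext_prj_hom E.
have h n : exists v : M, cm_act n x c == ext_inj E v.
  have /ext_exact [v ->] : ext_prj E (cm_act n x c) = 0 by rewrite pa.
  by exists v.
by exists (fun n => xchoose (h n)) => n; apply/eqP/(xchooseP (h n)).
Qed.

(** Applying [d, x_lambda] = - lambda x_lambda to the lift gives (d + lambda - gamma) f = x_lambda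
    (a v_Delta); this is its coefficient of lambda^n. *)
Lemma act_lift_rec E (c : E) (x : W_lca b) (a : K) (f : nat -> M) :
  cm_d c = gamma *: c + ext_inj E a%:P ->
  (forall n, cm_act n x c = ext_inj E (f n)) ->
  forall n, ('X - gamma%:P) * (f n : {poly K}) =
    M_act alpha Delta n x a%:P - lam_mul f n.
Proof.
move=> dc hf n; have [il id ia] := ext_inj_hom E.
have [_ _ ar _ _ adr _] := cm_ax E.
have := adr n x c; rewrite dc (linear_atD (ar _ _)) (linear_atZ (ar _ _)) !hf.
rewrite -id -ia -(linear_atZ il) -(linear_atD il) -(linear_atN il).
rewrite -(linear_atD il).
have -> : - lam_mul (fun k => cm_act k x c) n = ext_inj E (- lam_mul f n).
  case: n => [|n] /=; first by rewrite !oppr0 (linear_at0 il).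
  by rewrite hf (linear_atN il).
move/(@ext_injective _ _ _ _ E); rewrite /= /M_d => e.
rewrite -[in RHS]e -mul_polyC; ring.
Qed.

Lemma act_lift_fin E (c : E) (x : W_lca b) (f : nat -> M) :
  (forall n, cm_act n x c = ext_inj E (f n)) ->
  exists N, forall n, (N <= n)%N -> f n = 0.
Proof.
move=> hf; have [il _ _] := ext_inj_hom E; have [_ _ _ af _ _ _] := cm_ax E.
have [N hN] := af x c; exists N => n /hN h.
by apply: (@ext_injective _ _ _ _ E); rewrite -hf h (linear_at0 il).
Qed.

(* Descending induction: f n is the product of f n.+1 by gamma - d. *)
Lemma poly_rec0 (f : nat -> {poly K}) (m : nat) :
  (exists N, forall n, (N <= n)%N -> f n = 0) ->
  (forall n, (m <= n)%N -> ('X - gamma%:P) * f n.+1 = - f n) ->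
  forall n, (m <= n)%N -> f n = 0.
Proof.
move=> [N hN] hf n mn; have [k hk] : exists k, f (n + k)%N = 0.
  by exists N; apply: hN; rewrite leq_addl.
elim: k hk => [|k IH]; first by rewrite addn0.
move=> hk; apply: IH; apply: oppr_inj.
by rewrite -hf ?(leq_trans mn) ?leq_addr // -addnS hk mulr0 oppr0.
Qed.

Lemma ext_given_by E : exists2 a : K, given_by E a &
  a = 0 \/ alpha + gamma = 0 /\ Delta = 1.
Proof.
have [c c1 [a dc]] := ext_lift_poly E; have [il _ _] := ext_inj_hom E.
have [f hf] := act_lift_poly E c L c1; have [g hg] := act_lift_poly E c H c1.
have rf := act_lift_rec E c L a f dc hf.
have rg := act_lift_rec E c H a g dc hg.
have g0 n : g n = 0.
  apply: (poly_rec0 g 0) => // [|k _]; first exact: act_lift_fin hg.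
  by rewrite rg M_actH sub0r.
(* L_lambda v_Delta has degree at most one in lambda, so the recursion is homogeneous from index 2
   on. *)
have f0 n : (1 <= n)%N -> f n = 0.
  apply: (poly_rec0 f) => [|k k1]; first exact: act_lift_fin hf.
  by rewrite rf M_actL; case: k k1 => [|k] //= _; rewrite mulr0 sub0r.
have fE : f 0%N = (a * Delta)%:P.
  have := rf 1%N; rewrite f0 // mulr0 M_actL /= -polyCM => /esym/eqP.
  by rewrite subr_eq0 => /eqP.
(* The coefficient of lambda^0 reads (d - gamma) a Delta = a (d + alpha). Its coefficient of d gives
   [e1], its value at d = gamma gives [e2]. *)
have := rf 0%N; rewrite M_actL /= subr0 fE => e.
have e1 : a * Delta = a.
  have := congr1 (fun p : {poly K} => p`_1) e.
  by rewrite mulrC mul1r !coefCM coefB coefD coefX !coefC /= subr0 add0r !mulr1.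
have e2 : a * (alpha + gamma) = 0.
  move: e; rewrite e1 => /(congr1 (fun p : {poly K} => p.[gamma])).
  by rewrite !hornerE subrr mul0r => <-.
exists a.
  exists c; split=> // [[|n]|n]; rewrite ?hf ?hg.
  - by rewrite fE e1.
  - by rewrite f0 // (linear_at0 il).
  - by rewrite g0 (linear_at0 il).
have [->|a0] := eqVneq a 0; [by left|right].
split; apply: (mulfI a0); first by rewrite e2 mulr0.
by rewrite e1 mulr1.
Qed.

(** * Classification of extensions by [a] *)

(** Each extension is the sum of M and the line through its lift. The map [psi], the identity on M
    with c sent to c', commutes with all actions because these have the same M-components on c and
    c'. *)
Lemma given_by_equiv E E' (a : K) :
  given_by E a -> given_by E' a -> ext_equiv E E'.
Proof.
move=> [c [c1 cL cH cd]] [c' [c1' cL' cH' cd']].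
have [il id ia] := ext_inj_hom E; have [pl pd pa] := ext_prj_hom E.
have [il' id' ia'] := ext_inj_hom E'; have [pl' pd' pa'] := ext_prj_hom E'.
have [dl al ar _ adl _ _] := cm_ax E.
have [dl' al' ar' _ adl' _ _] := cm_ax E'.
have dec (e : E) : exists v : M, e - (ext_prj E e : K) *: c == ext_inj E v.
  have /ext_exact [v ->] : ext_prj E (e - (ext_prj E e : K) *: c) = 0.
    rewrite (linear_atD pl) (linear_atN pl) (linear_atZ pl) c1.
    by rewrite [_ *: _]mulr1 subrr.
  by exists v.
pose h e := xchoose (dec e).
have hE (e : E) : e = ext_inj E (h e) + (ext_prj E e : K) *: c.
  by rewrite -(eqP (xchooseP (dec e))) subrK.
pose psi (e : E) : E' := ext_inj E' (h e) + (ext_prj E e : K) *: c'.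
have psiE (v : M) (k : K) : psi (ext_inj E v + k *: c) = ext_inj E' v + k *: c'.
  have pk : ext_prj E (ext_inj E v + k *: c) = k.
    rewrite (linear_atD pl) (linear_atZ pl) ext_prj_inj c1 add0r.
    exact: mulr1.
  rewrite /psi pk; congr (ext_inj _ _ + _); apply: (@ext_injective _ _ _ _ E).
  apply: (addIr (k *: c)); rewrite [RHS]hE pk //.
(* Only L and H are prescribed on the lifts; linearity and (d x)_lambda = - lambda x_lambda carry
   the agreement to all of W(b). *)
have act_c (x : W_lca b) n : exists2 v : M,
    cm_act n x c = ext_inj E v & cm_act n x c' = ext_inj E' v.
  elim/W_ind: x n => [k x y hx hy n|x hx [|n]|n|n].
  - have [u u1 u2] := hx n; have [v v1 v2] := hy n; exists (k *: u + v).
      by rewrite il -u1 -v1; exact: al.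
    by rewrite il' -u2 -v2; exact: al'.
  - exists 0; first by rewrite [LHS]adl oppr0 (linear_at0 il).
    by rewrite [LHS]adl' oppr0 (linear_at0 il').
  - have [v v1 v2] := hx n; exists (- v).
      by rewrite [LHS]adl (linear_atN il) -v1.
    by rewrite [LHS]adl' (linear_atN il') -v2.
  - exists (if n == 0%N then a%:P else 0); rewrite ?cL ?cL'.
      by case: ifP; rewrite // (linear_at0 il).
    by case: ifP; rewrite // (linear_at0 il').
  - by exists 0; rewrite ?cH ?cH' ?(linear_at0 il) ?(linear_at0 il').
exists psi; split.
- split.
  + move=> k u v; rewrite [u]hE [v]hE !psiE !scalerDr !scalerA.
    rewrite addrACA -scalerDl -(linear_atZ il) -(linear_atD il) psiE.
    by rewrite addrACA -scalerDl -(linear_atZ il') -(linear_atD il').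
  + move=> u; rewrite [u]hE psiE (linear_atD dl) (linear_atZ dl) cd.
    rewrite (linear_atD dl') (linear_atZ dl') cd' -id -id' !scalerDr !scalerA.
    rewrite -(linear_atZ il) -(linear_atZ il').
    rewrite [_ + ext_inj E _]addrC [_ + ext_inj E' _]addrC !addrA.
    by rewrite -(linear_atD il) -(linear_atD il') psiE.
  + move=> n x u; rewrite [u]hE psiE; have [v v1 v2] := act_c x n.
    rewrite (linear_atD (ar _ _)) (linear_atZ (ar _ _)) v1.
    rewrite (linear_atD (ar' _ _)) (linear_atZ (ar' _ _)) v2 -ia -ia'.
    rewrite -(linear_atZ il) -(linear_atZ il') -(linear_atD il) -(linear_atD il').
    by have := psiE (cm_act n x (h u) + (ext_prj E u : K) *: v) 0; rewrite !scale0r !addr0.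
- by move=> v; have := psiE v 0; rewrite !scale0r !addr0.
- move=> u; rewrite /psi (linear_atD pl') (linear_atZ pl') c1' ext_prj_inj add0r.
  exact: mulr1.
Qed.

Lemma given_by_dsum0 : given_by (dsum_extension C M) 0.
Proof.
exists (0, 1); split=> //.
- by case=> [|n]; congr pair; rewrite /= /M_act lam_ext0r ?polyC0.
- by move=> n; congr pair; rewrite /= /M_act lam_ext0r.
- rewrite /= /dsum_d /=; congr pair; rewrite /=.
  + by rewrite /M_d mulr0 scaler0 add0r.
  + by rewrite addr0.
Qed.

Lemma given_by_trivial E (a : K) : given_by E a -> ext_trivial E <-> a = 0.
Proof.
move=> Ea; split=> [[psi [[psil psid _] psii psip]]|a0]; last first.
  by apply: given_by_equiv given_by_dsum0; rewrite -a0.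
have [c [c1 _ _ dc]] := Ea.
(* The M-component m of [psi c] satisfies (d - gamma) m = a, whose left side vanishes at gamma. *)
have := congr1 (fun u : dsum_extension C M => (u.1 : {poly K}).[gamma]) (psid c).
rewrite dc (linear_atD psil) (linear_atZ psil) psii /= /M_d !hornerE => /(canRL (addKr _)) ->.
exact: addNr.
Qed.

(** * Cocycles modulo coboundaries *)

Section Cocycles.
Implicit Types z : cochain C M.

(** Replacing the lift (0, 1) by (phi, 1) changes [z.1 1] by a multiple of d - gamma, so its value
    at gamma survives. *)
Lemma given_by_twisted z (hz : cocycle z) :
  given_by (twisted_extension hz) (z.1 1).[gamma].
Proof.
have [a [[phi w] [/= w1 cL cH dc]] _] := ext_given_by (twisted_extension hz).
suff -> : (z.1 1).[gamma] = a by exists (phi, w).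
have := congr1 (fun u => (u.1 : {poly K}).[gamma]) dc.
by rewrite /= w1 /M_d !hornerE => /addrI.
Qed.

Lemma coboundary_horner z : coboundary z <-> cocycle z /\ (z.1 1).[gamma] = 0.
Proof.
split=> [[hz /(given_by_trivial _ _ (given_by_twisted z hz)) //]|[hz h]].
by exists hz; apply/(given_by_trivial _ _ (given_by_twisted z hz)).
Qed.

End Cocycles.

End Extensions.

(** * Realization when alpha + gamma = 0 and Delta = 1 *)

Section BasicCocycle.
Variables (K : fieldType) (b alpha gamma : K).
Hypothesis alpha_gamma : alpha + gamma = 0.
Local Notation C := (C_mod b gamma).
Local Notation M := (M_mod b alpha 1).

(* d c = gamma c + v_1 and (f(d) L + g(d) H)_lambda c = f(- lambda) v_1. *)
Definition basic_cochain : cochain C M :=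
  (fun w : K => w%:P, fun n x (w : K) => lam_ext 1 n x.1 w%:P).

Lemma basic_cocycle : cocycle basic_cochain.
Proof.
(* The embedding into M(alpha, 0) sends v_1 to (d + alpha) v_0 and c to v_0. *)
pose f (u : (M * C)%type) : M_mod b alpha 0 :=
  ('X + alpha%:P) * (u.1 : {poly K}) + (u.2 : K)%:P.
have gammaE : gamma = - alpha by apply/eqP; rewrite -addr_eq0 addrC alpha_gamma.
apply: (conformal_action_inj _ _ _ _ _ _ _ _ _ _ f _ _ _ _ (cm_ax (M_mod b alpha 0))).
- move=> k [u1 u2] [v1 v2]; rewrite /f /=.
  rewrite -!mul_polyC polyCD polyCM; ring.
- move=> [u1 u2] [v1 v2]; rewrite /f /= => e.
  (* At d = - alpha the submodule part vanishes. *)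
  have e2 : u2 = v2.
    have := congr1 (fun p : {poly K} => p.[- alpha]) e.
    by rewrite !hornerE addNr !mul0r !add0r.
  congr pair => //; move: e; rewrite e2 => /addIr; apply: mulfI.
  by rewrite -[alpha]opprK polyCN polyXsubC_eq0.
- move=> [v w]; rewrite /f /= /M_d /C_d gammaE polyCM polyCN; ring.
- move=> n x [v w]; rewrite /f /= /M_act /= /lam_ext /at_d_lam.
  have -> : (('X + alpha%:P) * v + w%:P)^:P =
      ('X + alpha%:P%:P) * v^:P + w%:P%:P :> {poly {poly K}}.
    by rewrite rmorphD rmorphM rmorphD /= map_polyX !map_polyC.
  rewrite -coefD -coefCM addr0 map_polyC /=.
  rewrite comp_polyD comp_polyM comp_polyD comp_polyX !comp_polyC.
  rewrite -!mul_polyC !polyCD; congr ((polyseq _)`_n); ring.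
Qed.

Lemma horner_basic_cochain (a : K) :
  ((a *: basic_cochain).1 1 : {poly K}).[gamma] = a.
Proof. by rewrite /= hornerZ hornerC mulr1. Qed.

Lemma given_by_exists (a : K) : exists E : extension C M, given_by E a.
Proof.
have hz : cocycle (a *: basic_cochain).
  (* Written as (a - 1) z + z, the multiple is a combination of cocycles already at hand. *)
  rewrite -[a](subrK 1) scalerDl scale1r.
  by apply: cocycle_linear; exact: basic_cocycle.
exists (twisted_extension hz).
have := given_by_twisted _ _ _ _ _ _ hz; rewrite horner_basic_cochain.
exact.
Qed.

(** The linear functional sending z to the value of [z.1 1] at gamma has the coboundaries as its
    kernel on cocycles, and equals 1 on [basic_cochain]. *)
Lemma Ext_dim1 : Ext_dim C M 1.
Proof.
exists (fun=> basic_cochain); split=> [_|z hz]; first exact: basic_cocycle.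
have hornerB (c : 'rV[K]_1) :
    ((z - \sum_i c 0 i *: basic_cochain).1 1 : {poly K}).[gamma] =
    (z.1 1 : {poly K}).[gamma] - c 0 0.
  rewrite big_ord1 -scaleNr.
  have -> : (z + - c 0 0 *: basic_cochain).1 1 =
      (z.1 1 : {poly K}) + (- c 0 0 *: basic_cochain).1 1 by [].
  by rewrite hornerD horner_basic_cochain.
exists (const_mx (z.1 1 : {poly K}).[gamma]); split.
  apply/coboundary_horner; rewrite hornerB mxE subrr; split=> //.
  rewrite big_ord1 -scaleNr addrC; apply: cocycle_linear => //.
  exact: basic_cocycle.
move=> c /coboundary_horner [_]; rewrite hornerB => /eqP.
by rewrite subr_eq0 => /eqP ->; apply/matrixP => i j; rewrite mxE !ord1.
Qed.

End BasicCocycle.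

Theorem theorem3p4 (R : realType) (b alpha gamma Delta : R[i])
    (hb : b != 0) (hDelta : Delta != 0) :
  ((exists E : extension (C_mod b gamma) (M_mod b alpha Delta), ~ ext_trivial E)
     <-> (alpha + gamma = 0 /\ Delta = 1))
  /\
  (alpha + gamma = 0 /\ Delta = 1 ->
     [/\ Ext_dim (C_mod b gamma) (M_mod b alpha Delta) 1,
         forall a : R[i], a != 0 ->
           exists E : extension (C_mod b gamma) (M_mod b alpha Delta),
             given_by E a,
         forall (a : R[i])
                (E E' : extension (C_mod b gamma) (M_mod b alpha Delta)),
           given_by E a -> given_by E' a -> ext_equiv E E'
       & forall E : extension (C_mod b gamma) (M_mod b alpha Delta),
           ~ ext_trivial E <-> exists2 a : R[i], a != 0 & given_by E a]).
Proof.
have dim1 : alpha + gamma = 0 /\ Delta = 1 ->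
    forall a, exists E : extension (C_mod b gamma) (M_mod b alpha Delta),
      given_by E a.
  by case=> ag ->; exact: given_by_exists.
split; first split.
- move=> [E nE]; have [a Ea [a0|//]] := ext_given_by _ _ _ _ _ E.
  by case: nE; apply/(given_by_trivial _ _ _ _ _ _ _ Ea).
(* Any nonzero constant would give a nontrivial extension; 1 is chosen. *)
- move=> /dim1 /(_ 1) [E E1]; exists E => /(given_by_trivial _ _ _ _ _ _ _ E1).
  by apply/eqP; exact: oner_neq0.
move=> h; split.
- by case: h => ag ->; exact: Ext_dim1.
- by move=> a _; exact: dim1.
- by move=> a E E'; exact: given_by_equiv.
move=> E; split=> [nE|[a a0 Ea]].
  have [a Ea _] := ext_given_by _ _ _ _ _ E; exists a => //.
  by apply/eqP => a0; apply/nE/(given_by_trivial _ _ _ _ _ _ _ Ea).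
by move=> /(given_by_trivial _ _ _ _ _ _ _ Ea); apply/eqP.
Qed.
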